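(* Let $\mathbf G_{\mathcal S}=\mathbf A*\mathbf B_\Omega$, where the indices $l_1,\dots,l_K\in\{1,\dots,L\}$ defining $\mathbf B_\Omega$ are distinct. Then $$\mathbf G_{\mathcal S}^{\mathrm H}\mathbf G_{\mathcal S}=(\mathbf A^{\mathrm H}\mathbf A)\odot(\mathbf B_\Omega^{\mathrm H}\mathbf B_\Omega).$$ Moreover, for $i\ne i'$ in $\{1,\dots,L\}$, the cross-correlation $\delta_{ii'}=\big|(\mathbf B^{i})^{\mathrm H}\mathbf B^{i'}\big|$ satisfies $\delta_{ii'}<1$ if $P<L$ and $\delta_{ii'}=0$ if $P=L$. Consequently, the cross-correlation of the new steering vectors (the columns of $\mathbf G_{\mathcal S}$) is lower than that of the primary steering vectors (the columns of $\mathbf A$), no matter whether $P$ is equal to $L$ or not: for $k\ne k'$, the $k$th and $k'$th columns $\mathbf g_k,\mathbf g_{k'}$ of $\mathbf G_{\mathcal S}$ satisfy $|\mathbf g_k^{\mathrm H}\mathbf g_{k'}|<|\mathbf a(\phi_k)^{\mathrm H}\mathbf a(\phi_{k'})|$. Specifically, when $P=L$ the new steering vectors are completely uncorrelated, $\mathbf g_k^{\mathrm H}\mathbf g_{k'}=0$ for $k\ne k'$, even though the primary steering vectors are correlated.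
   Context: Notation: $j=\sqrt{-1}$; $\odot$ is the Hadamard product; $*$ is the Khatri–Rao (column-wise Kronecker) product; $\mathbf B^{i}$ is the $i$th column of $\mathbf B$. $\mathbf A=[\mathbf a(\phi_1),\dots,\mathbf a(\phi_K)]\in\mathbb C^{M\times K}$ is the array manifold matrix of $M$ sensors, with steering vectors $\mathbf a(\phi)=[\exp(j\phi p_1),\dots,\exp(j\phi p_M)]^{\mathrm T}$ for fixed real sensor positions $p_m$ (for a uniform linear array $p_m=m-1$). $\mathbf B\in\mathbb C^{P\times L}$ has entries $B_{il}=\frac1{\sqrt L}\exp(j\frac{2\pi}{L}c_i l)$, $1\le i\le P$, $1\le l\le L$, for a sampling pattern of integers $0\le c_1<\dots<c_P\le L-1$ (so $P\le L$). $\mathbf B_\Omega$ is the $P\times K$ matrix whose $k$th column is $\mathbf B^{l_k}$. Here $P$ is the number of branches per sensor, $L$ the sampling-rate reduction factor, and $l_k$ the index of the sub-band occupied by the $k$th signal.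
   Formalization: The strict inequality between the cross-correlations of new and primary steering vectors is claimed only when a(φ_k)^H a(φ_k') is nonzero (otherwise both sides are 0 and it fails); the non-strict inequality is claimed for all k ≠ k'. *)

(* Defs.v *)
From HB Require Import structures.
From mathcomp Require Import all_boot all_order all_algebra.
From mathcomp.real_closed Require Import complex.
From mathcomp.real_closed Require mxtens.
From mathcomp Require Import reals trigo.

Set Implicit Arguments.
Unset Strict Implicit.
Unset Printing Implicit Defensive.

Import Order.TTheory GRing.Theory Num.Theory.
Local Open Scope ring_scope.
Local Open Scope complex_scope.
Local Open Scope sesquilinear_scope.

(* exp (j t) for real t, by Euler's formula. *)
Definition expj (R : realType) (t : R) : R[i] := cos t +i* sin t.

Definition hadamard (C : comNzRingType) (m n : nat) (X Y : 'M[C]_(m, n)) :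
  'M[C]_(m, n) := map2_mx *%R X Y.

(* Column k is the Kronecker product of the k-th columns of X and Y; being a
   product of two one-column matrices, it has type 'cV_(m * p) up to
   conversion of 1 * 1 with 1. *)
Definition khatri_rao (C : comNzRingType) (m p n : nat)
    (X : 'M[C]_(m, n)) (Y : 'M[C]_(p, n)) : 'M[C]_(m * p, n) :=
  \matrix_(i, k) (mxtens.tensmx (col k X) (col k Y) : 'cV[C]_(m * p)) i 0.

(* u^H v. *)
Definition cdot (R : realType) (n : nat) (u v : 'cV[R[i]]_n) : R[i] :=
  (u ^t* *m v) 0 0.

(* |u^H v|, a nonnegative real seen in R[i]; x < y in R[i] means that y - x is
   real and positive. *)
Definition xcorr (R : realType) (n : nat) (u v : 'cV[R[i]]_n) : R[i] :=
  `| cdot u v |.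

Definition steering (R : realType) (M : nat) (pos : 'I_M -> R) (phi : R) :
  'cV[R[i]]_M := \col_m expj (phi * pos m).

Definition manifold (R : realType) (M K : nat) (pos : 'I_M -> R)
    (phi : 'I_K -> R) : 'M[R[i]]_(M, K) :=
  \matrix_(m, k) steering pos (phi k) m 0.

Definition sampling_pattern (P L : nat) (c : 'I_P -> nat) : Prop :=
  (forall i i' : 'I_P, (i < i')%N -> (c i < c i')%N) /\
  (forall i : 'I_P, (c i < L)%N).

(* Sub-bands are numbered 1, ..., L, whereas l : 'I_L runs over 0, ..., L - 1:
   the ordinal l stands for the number l.+1. *)
Definition sampling_mx (R : realType) (P L : nat) (c : 'I_P -> nat) :
  'M[R[i]]_(P, L) :=
  \matrix_(i, l) (((Num.sqrt (L%:R : R))^-1)%:C *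
                  expj (2 * pi / L%:R * (c i)%:R * (l.+1)%:R)).

(* The columns of the sampling matrix selected by the occupied sub-bands. *)
Definition sampling_sub (R : realType) (P L K : nat) (c : 'I_P -> nat)
    (l : 'I_K -> 'I_L) : 'M[R[i]]_(P, K) :=
  colsub l (sampling_mx R L c).

(* Main.v *)
Require Import Defs.
From HB Require Import structures.
From mathcomp Require Import all_boot all_order all_algebra.
From mathcomp.real_closed Require Import complex.
From mathcomp.real_closed Require mxtens.
From mathcomp Require Import reals trigo.
From mathcomp Require Import ring lra.

Set Implicit Arguments.
Unset Strict Implicit.
Unset Printing Implicit Defensive.

Import Order.TTheory GRing.Theory Num.Theory.
Local Open Scope ring_scope.
Local Open Scope complex_scope.
Local Open Scope sesquilinear_scope.

(* Columns of a Khatri-Rao product multiply their inner products, so it remains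
   to bound the inner products of the columns of B by 1.  With
   z = exp (j 2 pi (i' - i) / L) these are (1 / L) times the sum of z ^ c_q over
   q.  The triangle inequality bounds the modulus by P / L.  If P = L, the
   pattern exhausts 0, ..., L - 1, and the sum is a full geometric sum of an
   L-th root of unity other than 1, which vanishes. *)

Lemma expjD (R : realType) (s t : R) : expj (s + t) = expj s * expj t.
Proof.
apply/eqP; rewrite eq_complex /= cosD sinD eqxx.
by rewrite [cos s * sin t + _]addrC eqxx.
Qed.

Lemma expj0 (R : realType) : expj (0 : R) = 1.
Proof. by rewrite /expj cos0 sin0. Qed.

Lemma expjMn (R : realType) (t : R) (n : nat) : expj (t * n%:R) = expj t ^+ n.
Proof.
elim: n => [|n IHn]; first by rewrite mulr0 expj0.
by rewrite -natr1 mulrDr mulr1 expjD IHn exprSr.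
Qed.

Lemma conj_expj (R : realType) (t : R) : Num.conj (expj t) = expj (- t).
Proof. by rewrite [LHS]/= /expj cosN sinN. Qed.

Lemma norm_expj (R : realType) (t : R) : `|expj t| = 1.
Proof. by rewrite normc_def /= cos2Dsin2 sqrtr1. Qed.

Lemma expj_2pi_nat (R : realType) (n : nat) : expj (2 * pi * n%:R : R) = 1.
Proof.
have e1 : expj (2 * pi : R) = 1.
  by rewrite /expj mulr_natl cos2pi sin2pi.
by rewrite expjMn e1 expr1n.
Qed.

(** The real part alone decides: [cos t] equals 1 minus twice the square of [sin (t / 2)], and
    [t / 2] is a nonzero angle strictly between [- pi] and [pi], where the sine does not vanish. *)
Lemma expj_neq1 (R : realType) (t : R) :
  t != 0 -> `|t| < 2 * pi -> expj t != 1.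
Proof.
move=> t0 tpi.
have tE : t = (t / 2) *+ 2 by rewrite -mulr_natr divfK // pnatr_eq0.
suff s0 : sin (t / 2) != 0.
  rewrite /expj eq_complex /= negb_and; apply/orP; left.
  rewrite tE cos_mulr2n cos2sin2; apply: contra s0 => /eqP s0.
  by rewrite -sqrf_eq0; apply/eqP; lra.
(* Positivity of the sine is known on (0, [pi]); a negative [t] reduces to it by oddness. *)
move: t0; rewrite neq_lt => /orP[t_lt0|t_gt0].
  rewrite ltr0_norm // in tpi.
  rewrite -oppr_eq0 -sinN; apply/lt0r_neq0/sin_gt0_pi; lra.
rewrite gtr0_norm // in tpi.
apply/lt0r_neq0/sin_gt0_pi; lra.
Qed.

Lemma cdotE (R : realType) (n : nat) (u v : 'cV[R[i]]_n) :
  cdot u v = \sum_q Num.conj (u q 0) * v q 0.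
Proof. by rewrite /cdot mxE; apply: eq_bigr => q _; rewrite !mxE. Qed.

Lemma gramE (R : realType) (m n : nat) (X : 'M[R[i]]_(m, n)) (k k' : 'I_n) :
  (X ^t* *m X) k k' = cdot (col k X) (col k' X).
Proof. by rewrite cdotE mxE; apply: eq_bigr => q _; rewrite !mxE. Qed.

Lemma khatri_raoE (C : comNzRingType) (m p n : nat)
    (X : 'M[C]_(m, n)) (Y : 'M[C]_(p, n)) (i : 'I_m) (j : 'I_p) (k : 'I_n) :
  khatri_rao X Y (mxtens.mxtens_index (i, j)) k = X i k * Y j k.
Proof. by rewrite !mxE mxtens.mxtens_indexK. Qed.

(** The rows of the product are in bijection with pairs of row indices through [mxtens_index], and
    each summand separates, so the sum over rows is a product of two sums. *)
Lemma cdot_khatri_rao (R : realType) (m p n : nat)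
    (X : 'M[R[i]]_(m, n)) (Y : 'M[R[i]]_(p, n)) (k k' : 'I_n) :
  cdot (col k (khatri_rao X Y)) (col k' (khatri_rao X Y)) =
  cdot (col k X) (col k' X) * cdot (col k Y) (col k' Y).
Proof.
rewrite !cdotE big_distrlr pair_big /=.
rewrite (reindex (@mxtens.mxtens_index m p)) /=; last first.
  exists (@mxtens.mxtens_unindex m p) => q _.
    exact: mxtens.mxtens_indexK.
  exact: mxtens.mxtens_unindexK.
apply: eq_bigr => -[q r] _.
by rewrite ![col _ _ _ _]mxE !khatri_raoE rmorphM mulrACA.
Qed.

Lemma gram_khatri_rao (R : realType) (m p n : nat)
    (X : 'M[R[i]]_(m, n)) (Y : 'M[R[i]]_(p, n)) :
  (khatri_rao X Y) ^t* *m khatri_rao X Y =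
  hadamard (X ^t* *m X) (Y ^t* *m Y).
Proof.
apply/matrixP => k k'; rewrite gramE cdot_khatri_rao.
by rewrite [RHS]mxE !gramE.
Qed.

Lemma col_manifold (R : realType) (M K : nat) (pos : 'I_M -> R)
    (phi : 'I_K -> R) (k : 'I_K) :
  col k (manifold pos phi) = steering pos (phi k).
Proof. by apply/colP => m; rewrite !mxE. Qed.

Lemma col_sampling_sub (R : realType) (P L K : nat) (c : 'I_P -> nat)
    (l : 'I_K -> 'I_L) (k : 'I_K) :
  col k (sampling_sub R c l) = col (l k) (sampling_mx R L c).
Proof. by apply/colP => m; rewrite !mxE. Qed.

Lemma sampling_pattern_inj (P L : nat) (c : 'I_P -> nat) :
  sampling_pattern L c -> injective c.
Proof.
move=> [c_incr _] q r eq_c; apply/val_inj.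
by case: (ltngtP q r) => [/c_incr|/c_incr|//]; rewrite eq_c ltnn.
Qed.

(** The pattern embeds ['I_P] into ['I_L]. Hence the cases [P < L] and [P = L] are exhaustive. *)
Lemma sampling_pattern_leq (P L : nat) (c : 'I_P -> nat) :
  sampling_pattern L c -> (P <= L)%N.
Proof.
move=> c_pattern; have [_ c_lt] := c_pattern.
rewrite -(card_ord P) -(card_ord L).
apply: (leq_card (fun q => Ordinal (c_lt q))) => q r [].
exact: (sampling_pattern_inj c_pattern).
Qed.

Lemma cdot_sampling_mx (R : realType) (P L : nat) (c : 'I_P -> nat)
    (i i' : 'I_L) :
  cdot (col i (sampling_mx R L c)) (col i' (sampling_mx R L c)) =
  L%:R^-1 * \sum_q expj (2 * pi / L%:R * (i'%:R - i%:R) : R) ^+ c q.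
Proof.
rewrite cdotE mulr_sumr; apply: eq_bigr => q _; rewrite !mxE -expjMn.
set s := (_^-1)%:C.
have ss : s * s = L%:R^-1.
  by rewrite -rmorphM /= -invfM -expr2 sqr_sqrtr ?ler0n // fmorphV /= rmorph_nat.
rewrite rmorphM /= mulrACA -ss.
have -> : Num.conj s = s by exact: conjc_real.
(* The shift by one in the numbering of the sub-bands cancels in the difference of the phases. *)
rewrite conj_expj -expjD -!natr1; congr (_ * expj _).
by ring.
Qed.

(** An injection of ['I_L] into itself is a permutation, so the sum is only reordered. *)
Lemma sampling_pattern_sum (C : nzRingType) (L : nat) (c : 'I_L -> nat)
    (f : nat -> C) :
  sampling_pattern L c -> \sum_q f (c q) = \sum_(q < L) f q.
Proof.
move=> c_pattern; have [_ c_lt] := c_pattern.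
rewrite [RHS](reindex_inj (h := fun q => Ordinal (c_lt q))) // => q r [].
exact: (sampling_pattern_inj c_pattern).
Qed.

Lemma cdot_sampling_full (R : realType) (P L : nat) (c : 'I_P -> nat)
    (i i' : 'I_L) :
  sampling_pattern L c -> P = L -> i != i' ->
  cdot (col i (sampling_mx R L c)) (col i' (sampling_mx R L c)) = 0.
Proof.
move=> c_pattern PL ii'; move: c c_pattern; rewrite PL => c c_pattern.
rewrite cdot_sampling_mx; set z := expj _.
rewrite (sampling_pattern_sum (fun n => z ^+ n) c_pattern).
have L_gt0 : (0 : R) < L%:R by rewrite ltr0n (leq_ltn_trans _ (ltn_ord i)).
have L_neq0 := lt0r_neq0 L_gt0.
(* The phase of [z ^+ L] is a difference of two integer multiples of [2 * pi]. *)
have zL : z ^+ L = 1.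
  rewrite /z -expjMn.
  have -> : 2 * pi / L%:R * (i'%:R - i%:R) * L%:R =
            2 * pi * i'%:R - 2 * pi * i%:R :> R by field.
  by rewrite expjD -conj_expj !expj_2pi_nat mul1r rmorph1.
have z1 : z != 1.
  have pi0 := pi_gt0 R.
  have d_neq0 : i'%:R - i%:R != 0 :> R.
    by rewrite subr_eq0 eqr_nat eq_sym.
  apply: expj_neq1.
    by rewrite !mulf_neq0 ?d_neq0 ?invr_eq0 ?lt0r_neq0.
  have piL : 0 < 2 * pi / L%:R :> R by rewrite divr_gt0 ?mulr_gt0.
  (* Writing [2 * pi] as [2 * pi / L%:R * L%:R] reduces the bound on the phase to [i'] and [i]
     differing by less than [L]. *)
  rewrite normrM (gtr0_norm piL) -[ltRHS](divfK L_neq0) ltr_pM2l //.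
  have iL : i%:R < L%:R :> R by rewrite ltr_nat.
  have i'L : i'%:R < L%:R :> R by rewrite ltr_nat.
  have i0 : 0 <= i%:R :> R by exact: ler0n.
  have i'0 : 0 <= i'%:R :> R by exact: ler0n.
  by rewrite ltr_norml; apply/andP; split; lra.
(* [z ^+ L - 1] is [z - 1] times the geometric sum; it vanishes while [z - 1] does not. *)
have /esym/eqP := subrX1 z L; rewrite zL subrr mulf_eq0 subr_eq0 (negPf z1) /=.
by move/eqP => ->; rewrite mulr0.
Qed.

Lemma xcorr_sampling_lt1 (R : realType) (P L : nat) (c : 'I_P -> nat)
    (i i' : 'I_L) :
  (P < L)%N ->
  xcorr (col i (sampling_mx R L c)) (col i' (sampling_mx R L c)) < 1.
Proof.
move=> PL; have L_gt0 : (0 : R[i]) < L%:R by rewrite ltr0n (leq_ltn_trans _ PL).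
rewrite /xcorr cdot_sampling_mx normrM normfV normr_nat ltr_pdivrMl // mulr1.
apply: (@le_lt_trans _ _ P%:R); last by rewrite ltr_nat.
apply: le_trans (ler_norm_sum _ _ _) _.
under eq_bigr do rewrite normrX norm_expj expr1n.
by rewrite sumr_const card_ord.
Qed.

Theorem mainTheorem5 (R : realType) (M K P L : nat)
    (pos : 'I_M -> R) (phi : 'I_K -> R) (c : 'I_P -> nat) (l : 'I_K -> 'I_L)
    (c_pattern : sampling_pattern L c) (l_distinct : injective l) :
  let a (k : 'I_K) := steering pos (phi k) in
  let A := manifold pos phi in
  let B := sampling_mx R L c in
  let BO := sampling_sub R c l in
  let G := khatri_rao A BO in
  [/\ G ^t* *m G = hadamard (A ^t* *m A) (BO ^t* *m BO),
      forall i i' : 'I_L, i != i' ->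
        ((P < L)%N -> xcorr (col i B) (col i' B) < 1) /\
        (P = L -> xcorr (col i B) (col i' B) = 0),
      forall k k' : 'I_K, k != k' ->
        xcorr (col k G) (col k' G) <= xcorr (a k) (a k') /\
        (cdot (a k) (a k') != 0 ->
         xcorr (col k G) (col k' G) < xcorr (a k) (a k')) &
      P = L -> forall k k' : 'I_K, k != k' -> cdot (col k G) (col k' G) = 0].
Proof.
move=> a A B BO G.
have cdotG k k' : cdot (col k G) (col k' G) =
    cdot (a k) (a k') * cdot (col (l k) B) (col (l k') B).
  by rewrite cdot_khatri_rao !col_manifold !col_sampling_sub.
have lB_neq k k' : k != k' -> l k != l k' by rewrite (inj_eq l_distinct).
have B_full i i' : P = L -> i != i' -> cdot (col i B) (col i' B) = 0.
  exact: cdot_sampling_full.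
(* One strict bound for both cases: for [P = L] the correlation is 0. *)
have B_lt1 i i' : i != i' -> xcorr (col i B) (col i' B) < 1.
  move=> ii'; have := sampling_pattern_leq c_pattern.
  rewrite leq_eqVlt => /orP[/eqP PL|]; last exact: xcorr_sampling_lt1.
  by rewrite /xcorr B_full // normr0.
split.
- exact: gram_khatri_rao.
- move=> i i' ii'; split; first by move=> _; exact: B_lt1.
  by move=> PL; rewrite /xcorr B_full ?normr0.
- move=> k k' /lB_neq/B_lt1 lt1.
  (* A factor below 1 never increases the primary correlation, and decreases it strictly once that
     correlation is nonzero; if it is zero, both sides are 0. *)
  rewrite {1 3}/xcorr cdotG normrM; split=> [|a_neq0].
    by rewrite ler_piMr // ltW.
  by rewrite gtr_pMr // normr_gt0.
- by move=> PL k k' /lB_neq kk'; rewrite cdotG B_full ?mulr0.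
Qed.
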